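(* Let $G$ be a topological group, $H$ a closed normal subgroup and $\pi\colon G\to G/H$ the quotient map. Then $$\mathcal E_q(G/H)=\mathcal E_L(G/H)=\mathcal E_{\rm Haus}(G/H)$$ if and only if every $\mathcal E_{\rm Haus}(G/H)$-bounded set is of the form $\pi[A]$ for some bounded set $A\subseteq G$.
   Context: A coarse structure on a set $X$ is an ideal $\mathcal E$ of subsets of $X\times X$ (closed under subsets and finite unions) containing the diagonal and closed under transposition and composition $E\circ F=\{(x,z): \exists y\ (x,y)\in E,\ (y,z)\in F\}$. A pseudometric $d$ on $X$ induces $\mathcal E_d(X)=\{E\subseteq X\times X:\sup_{(x,y)\in E}d(x,y)<\infty\}$. A set $A\subseteq X$ is $\mathcal E$-bounded if $A\times A\in\mathcal E$. A map $\phi\colon(X,\mathcal E)\to(Y,\mathcal F)$ is controlled if $(\phi\times\phi)[E]\in\mathcal F$ for all $E\in\mathcal E$. For a topological group $G$, the left coarse structure is $\mathcal E_L(G)=\bigcap_d\mathcal E_d(G)$, where $d$ ranges over all continuous left-invariant pseudometrics on $G$. A subset of $G$ is called bounded if it is $\mathcal E_L(G)$-bounded. For a closed normal subgroup $H$, $\mathcal E_L(G/H)$ is the left coarse structure of the topological quotient group $G/H$; $\mathcal E_q(G/H)$ is the smallest coarse structure on $G/H$ making $\pi\colon (G,\mathcal E_L(G))\to G/H$ controlled; and $\mathcal E_{\rm Haus}(G/H)=\bigcap_d\mathcal E_{d_{\rm Haus}}(G/H)$, where $d$ ranges over the continuous left-invariant pseudometrics on $G$ and $d_{\rm Haus}$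 is the Hausdorff distance between cosets with respect to $d$, which satisfies $d_{\rm Haus}(Hg,Hf)=\inf_{h\in H}d(hg,f)$. *)

(* Defs.v *)
From HB Require Import structures.
From mathcomp Require Import all_boot all_order all_algebra generic_quotient.
From mathcomp Require Import all_classical all_reals.
From mathcomp Require Import ereal topology normedtype.

Set Implicit Arguments.
Unset Strict Implicit.
Unset Printing Implicit Defensive.

Import Order.TTheory GRing.Theory Num.Theory.
Import numFieldNormedType.Exports.

Local Open Scope classical_set_scope.
Local Open Scope ring_scope.
Local Open Scope quotient_scope.
Local Open Scope group_scope.

HB.structure Definition PreTopologicalGroup :=
  {G of Topological G & Group G}.

HB.mixin Record PreTopologicalGroup_isTopologicalGroup G
    & PreTopologicalGroup G := {
  mulg_continuous : continuous (fun x : G * G => x.1 * x.2) ;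
  invg_continuous : continuous (fun x : G => x^-1)
}.

(* No separation axiom is required. *)
#[short(type="topologicalGroupType")]
HB.structure Definition TopologicalGroup :=
  {G of PreTopologicalGroup G & PreTopologicalGroup_isTopologicalGroup G}.

HB.mixin Record isConjClosed (G : groupType) (S : {pred G}) := {
  gpred_conj : forall x g : G, x \in S -> x ^ g \in S
}.

(* Normal subgroups, extending the subgroup predicates of the library. *)
#[short(type="normalSubgroup")]
HB.structure Definition NormalSubgroup (G : groupType) :=
  {S of GroupClosed G S & isConjClosed G S}.

Section QuotientGroup.
Context {G : topologicalGroupType} (H : normalSubgroup G).

(* [x] and [y] are identified when [H x = H y]. *)
Let coset_rel' (x y : G) := x / y \in H.

Fact coset_rel_refl : reflexive coset_rel'.
Proof. by move=> x; rewrite /coset_rel' divgg gpred1. Qed.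

Fact coset_rel_sym : symmetric coset_rel'.
Proof. by move=> x y; rewrite /coset_rel' gpredFC. Qed.

Fact coset_rel_trans : transitive coset_rel'.
Proof.
move=> y x z; rewrite /coset_rel' => xy yz.
have -> : x / z = (x / y) * (y / z) by rewrite mulgA mulgVK.
exact: gpredM.
Qed.

Definition coset_rel := EquivRel _ coset_rel_refl coset_rel_sym coset_rel_trans.

Definition quotient_group := {eq_quot coset_rel}.

HB.instance Definition _ :=
  Topological.copy quotient_group (quotient_topology quotient_group).
HB.instance Definition _ := Quotient.on quotient_group.

Definition quotient_map (x : G) : quotient_group := \pi_quotient_group x.

Local Notation Q := quotient_group.
Local Notation q := quotient_map.

Lemma quotient_map_eq x y : q x = q y <-> x / y \in H.
Proof. by split=> [/eqmodP|?]; [|apply/eqmodP]. Qed.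

Lemma quotient_map_surj (u : Q) : exists x, q x = u.
Proof. by exists (repr u); rewrite /q reprK. Qed.

Definition quotient_one : Q := q 1.
Definition quotient_inv (u : Q) : Q := q (repr u)^-1.
Definition quotient_mul (u v : Q) : Q := q (repr u * repr v).

Lemma quotient_reprE x : repr (q x) / x \in H.
Proof. by apply/quotient_map_eq; rewrite /q reprK. Qed.

Lemma quotient_map_mul x y : quotient_mul (q x) (q y) = q (x * y).
Proof.
apply/quotient_map_eq.
set x' := repr (q x); set y' := repr (q y).
have -> : x' * y' / (x * y) = (x' / x) * (y' / y) ^ x^-1.
  by rewrite /conjg invgK invgM !mulgA mulgVK.
by rewrite gpredM ?gpred_conj ?quotient_reprE.
Qed.

Lemma quotient_map_inv x : quotient_inv (q x) = q x^-1.
Proof.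
apply/quotient_map_eq; set x' := repr (q x).
have -> : x'^-1 / x^-1 = ((x' / x)^-1) ^ x.
  by rewrite /conjg invgK invgF -!mulgA mulKg.
by rewrite gpred_conj ?gpredV ?quotient_reprE.
Qed.

Fact quotient_mulA : associative quotient_mul.
Proof.
move=> u v w; have [x <-] := quotient_map_surj u.
have [y <-] := quotient_map_surj v; have [z <-] := quotient_map_surj w.
by rewrite !quotient_map_mul mulgA.
Qed.

Fact quotient_mul1 : left_id quotient_one quotient_mul.
Proof.
by move=> u; have [x <-] := quotient_map_surj u; rewrite quotient_map_mul mul1g.
Qed.

Fact quotient_mulr1 : right_id quotient_one quotient_mul.
Proof.
by move=> u; have [x <-] := quotient_map_surj u; rewrite quotient_map_mul mulg1.
Qed.

Fact quotient_mulV : left_inverse quotient_one quotient_inv quotient_mul.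
Proof.
move=> u; have [x <-] := quotient_map_surj u.
by rewrite quotient_map_inv quotient_map_mul mulVg.
Qed.

Fact quotient_mulrV : right_inverse quotient_one quotient_inv quotient_mul.
Proof.
move=> u; have [x <-] := quotient_map_surj u.
by rewrite quotient_map_inv quotient_map_mul mulgV.
Qed.

HB.instance Definition _ := isGroup.Build Q quotient_mulA quotient_mul1
  quotient_mulr1 quotient_mulV quotient_mulrV.

Lemma quotient_map_continuous : continuous q.
Proof. exact: pi_continuous. Qed.

Lemma mulgl_continuous (g : G) : continuous (fun x : G => g * x).
Proof.
move=> x; apply: (@continuous_comp _ _ _ (fun x => (g, x))
  (fun p : G * G => p.1 * p.2)); last exact: mulg_continuous.
by apply: cvg_pair => /=; [exact: cvg_cst|exact: cvg_id].
Qed.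

Lemma quotient_map_open (U : set G) : open U -> open (q @` U).
Proof.
move=> oU; rewrite /open/= /quotient_open.
rewrite (_ : _ @^-1` _ = \bigcup_(h in [set` H]) ((fun x => h * x) @^-1` U)).
  apply: bigcup_open => h _; apply: open_comp => // x _.
  exact: mulgl_continuous.
apply/seteqP; split=> [x [y Uy /quotient_map_eq yx]|x [h /= Hh Uhx]].
  by exists (y / x) => //=; rewrite mulgVK.
by exists (h * x) => //; apply/quotient_map_eq; rewrite mulgK.
Qed.

Lemma quotient_map_nbhs x (A : set G) : nbhs x A -> nbhs (q x) (q @` A).
Proof.
rewrite nbhsE => -[U [oU Ux] UA]; rewrite nbhsE.
by exists (q @` U); [split; [exact: quotient_map_open|exists x]|exact: image_subset].
Qed.

Fact quotient_mul_continuous : continuous (fun u : Q * Q => u.1 * u.2).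
Proof.
move=> [u v]; have [x <-] := quotient_map_surj u.
have [y <-] := quotient_map_surj v => W /=.
rewrite [q x * q y]quotient_map_mul => /quotient_map_continuous.
move=> /(mulg_continuous (x, y)) [[A B] /= [nA nB] AB].
exists (q @` A, q @` B) => /=; first by split; exact: quotient_map_nbhs.
move=> [_ _] [/= [a Aa <-] [b Bb <-]].
by rewrite [q a * q b]quotient_map_mul; exact: (AB (a, b)).
Qed.

Fact quotient_inv_continuous : continuous (fun u : Q => u^-1).
Proof.
move=> u; have [x <-] := quotient_map_surj u => W /=.
rewrite [(q x)^-1]quotient_map_inv => /quotient_map_continuous.
move=> /(invg_continuous x) /quotient_map_nbhs; apply: filterS.
by move=> _ [a Wa <-] /=; rewrite [(q a)^-1]quotient_map_inv.
Qed.

HB.instance Definition _ := PreTopologicalGroup_isTopologicalGroup.Build Q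
  quotient_mul_continuous quotient_inv_continuous.

End QuotientGroup.

Record coarse_structure (X : Type) (E : set (set (X * X))) : Prop := {
  coarse_diagonal : E diagonal ;
  coarse_subset : forall A B, A `<=` B -> E B -> E A ;
  coarse_union : forall A B, E A -> E B -> E (A `|` B) ;
  coarse_transpose : forall A, E A -> E (A^-1)%relation ;
  coarse_compose : forall A B, E A -> E B -> E (B \; A)%relation
}.

Definition coarse_bounded (X : Type) (E : set (set (X * X))) (A : set X) :=
  E (A `*` A).

Definition controlled (X Y : Type) (E : set (set (X * X)))
    (F : set (set (Y * Y))) (f : X -> Y) :=
  forall A, E A -> F ((fun p => (f p.1, f p.2)) @` A).

Section Pseudometrics.
Context {R : realType}.

Record pseudometric (X : Type) (d : X -> X -> R) : Prop := {
  pseudometric_ge0 : forall x y, (0 <= d x y)%R ;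
  pseudometric_refl : forall x, d x x = 0%R ;
  pseudometric_sym : forall x y, d x y = d y x ;
  pseudometric_triangle : forall x y z, (d x z <= d x y + d y z)%R
}.

(* Distances take extended real values, so that the definition also applies to
   the Hausdorff distance without any finiteness side condition. *)
Definition induced_coarse (X : Type) (d : X -> X -> \bar R) :
    set (set (X * X)) :=
  [set E | (ereal_sup [set d p.1 p.2 | p in E] < +oo)%E].

Definition hausdorff_dist (X : Type) (d : X -> X -> R) (A B : set X) : \bar R :=
  maxe (ereal_sup [set ereal_inf [set (d a b)%:E | b in B] | a in A])
       (ereal_sup [set ereal_inf [set (d a b)%:E | a in A] | b in B]).

Definition left_invariant_pseudometric (G : topologicalGroupType)
    (d : G -> G -> R) : Prop :=
  [/\ pseudometric d,
      forall g x y : G, d (g * x) (g * y) = d x y &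
      continuous (fun p : G * G => d p.1 p.2)].

End Pseudometrics.

Definition left_coarse (R : realType) (G : topologicalGroupType) :
    set (set (G * G)) :=
  \bigcap_(d in [set d : G -> G -> R | left_invariant_pseudometric d])
    induced_coarse (fun x y => (d x y)%:E).
Arguments left_coarse : clear implicits.

Section QuotientCoarse.
Context (R : realType) {G : topologicalGroupType} (H : normalSubgroup G).

Definition coset_of_quotient (u : quotient_group H) : set G :=
  quotient_map H @^-1` [set u].

Definition quotient_coarse : set (set (quotient_group H * quotient_group H)) :=
  \bigcap_(F in [set F | coarse_structure F /\
                         controlled (left_coarse R G) F (quotient_map H)]) F.

Definition hausdorff_coarse : set (set (quotient_group H * quotient_group H)) :=
  \bigcap_(d in [set d : G -> G -> R | left_invariant_pseudometric d])
    induced_coarse (fun u v =>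
      hausdorff_dist d (coset_of_quotient u) (coset_of_quotient v)).

End QuotientCoarse.

Arguments quotient_coarse R {G} H.
Arguments hausdorff_coarse R {G} H.

(* Main.v *)
(** For a continuous left-invariant pseudometric [d] on [G], the Hausdorff
    distance between cosets is a finite continuous left-invariant pseudometric
    on [G/H], so [E_q <= E_L <= E_Haus] always holds.  By left invariance an
    entourage is governed by the set of its quotients [u^-1 v].  Bounded subsets
    of [G] are closed under unions, inverses and products, so the sets [E] for
    which [{u^-1 v | (u, v) in E}] lies in the image of a bounded set form a
    coarse structure, which is therefore exactly [E_q].  Both implications
    compare this description with the bounded sets of [E_Haus]. *)
Require Import Defs.
From HB Require Import structures.
From mathcomp Require Import all_boot all_order all_algebra generic_quotient.
From mathcomp Require Import all_classical all_reals.
From mathcomp Require Import ereal topology normedtype.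
From mathcomp Require Import lra.

Set Implicit Arguments.
Unset Strict Implicit.
Unset Printing Implicit Defensive.

Import Order.TTheory GRing.Theory Num.Theory.
Import numFieldNormedType.Exports.

Local Open Scope classical_set_scope.
Local Open Scope ring_scope.
Local Open Scope group_scope.

(** * Coarse structures induced by a pseudometric *)

Section InducedCoarse.
Context {R : realType} {X : Type}.

Lemma induced_coarseP (d : X -> X -> R) (E : set (X * X)) :
  induced_coarse (fun x y => (d x y)%:E) E <->
  exists M : R, forall x y, E (x, y) -> (d x y <= M)%R.
Proof.
rewrite /induced_coarse/=; split=> [supE|[M dM]].
  set s := ereal_sup _ in supE.
  have dle x y : E (x, y) -> ((d x y)%:E <= s)%E.
    by move=> Exy; apply: ereal_sup_ubound; exists (x, y).
  case: s supE dle => [r _ dle| //|_ dle].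
    by exists r => x y /dle; rewrite lee_fin.
  (* A supremum equal to [-oo] forces [E] to be empty, so any bound serves. *)
  by exists 0%R => x y /dle; rewrite leNgt ltNyr.
apply: (@le_lt_trans _ _ M%:E); last exact: ltry.
by apply: ge_ereal_sup => _ [[x y] Exy <-]; rewrite lee_fin; exact: dM.
Qed.

Lemma induced_coarse_structure (d : X -> X -> R) :
  pseudometric d -> coarse_structure (induced_coarse (fun x y => (d x y)%:E)).
Proof.
move=> [_ dxx dC dT]; split.
- by apply/induced_coarseP; exists 0%R => x y /diagonalP ->; rewrite dxx.
- move=> A B AB /induced_coarseP[M dM]; apply/induced_coarseP.
  by exists M => x y /AB /dM.
- move=> A B /induced_coarseP[M dM] /induced_coarseP[N dN].
  apply/induced_coarseP; exists (Num.max M N) => x y; rewrite le_max.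
  by case=> [/dM ->|/dN ->]; rewrite ?orbT.
- move=> A /induced_coarseP[M dM]; apply/induced_coarseP.
  by exists M => x y /= /dM; rewrite dC.
- move=> A B /induced_coarseP[M dM] /induced_coarseP[N dN].
  apply/induced_coarseP; exists (M + N)%R => x z /= [y /dM xy /dN yz].
  by apply: le_trans (dT x y z) _; exact: lerD.
Qed.

End InducedCoarse.

(** The triangle inequality gives $|d(x,y)-d(x',y')|\le d(x,x')+d(y,y')$, so joint continuity
    reduces to small balls being neighbourhoods of their centres. *)
Lemma pseudometric_continuous (R : realType) (T : topologicalType)
    (d : T -> T -> R) : pseudometric d ->
  (forall x (e : R), (0 < e)%R -> \forall y \near x, (d x y < e)%R) ->
  continuous (fun p : T * T => d p.1 p.2).
Proof.
move=> [_ _ dC dT] dnear [x y] /=; apply/cvgrPdist_lt => e e0.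
have e20 : (0 < e / 2)%R by lra.
exists ([set x' | (d x x' < e / 2)%R], [set y' | (d y y' < e / 2)%R]) => /=.
  by split; exact: dnear.
move=> [x' y'] [/= dx dy]; rewrite ltr_norml.
move: (dT x x' y) (dT x' y' y) (dT x' x y') (dT x y y').
rewrite (dC y' y) (dC x' x) => *; apply/andP; split; lra.
Qed.

(** * Bounded sets of the left coarse structure *)

Section LeftCoarse.
Context (R : realType) {G : topologicalGroupType}.
Implicit Types (A B : set G) (E : set (G * G)) (d : G -> G -> R).

Lemma left_invariant_dist1 d (x y : G) : left_invariant_pseudometric d ->
  d 1 (x^-1 * y) = d x y.
Proof. by move=> [_ dl _]; rewrite -(dl x) mulg1 mulVKg. Qed.

Lemma left_coarse_structure : coarse_structure (left_coarse R G).
Proof.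
have cs d : left_invariant_pseudometric d ->
    coarse_structure (induced_coarse (fun x y => (d x y)%:E)).
  by case=> pd _ _; exact: induced_coarse_structure.
split=> [d ld|A B AB EB d ld|A B EA EB d ld|A EA d ld|A B EA EB d ld].
- exact: coarse_diagonal (cs d ld).
- exact: (coarse_subset (cs d ld) AB (EB d ld)).
- exact: (coarse_union (cs d ld) (EA d ld) (EB d ld)).
- exact: (coarse_transpose (cs d ld) (EA d ld)).
- exact: (coarse_compose (cs d ld) (EA d ld) (EB d ld)).
Qed.

(** A bound on pairwise distances can be traded for a bound on distances from the identity, via the
    triangle inequality. *)
Lemma left_boundedP A : coarse_bounded (left_coarse R G) A <->
  forall d, left_invariant_pseudometric d ->
    exists M : R, forall a, A a -> (d 1%g a <= M)%R.
Proof.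
split=> [bA d ld|bA d ld].
  have /induced_coarseP[M dM] := bA d ld.
  (* A base point [a0] turns the diameter bound into a bound from [1]; without one, [A] is empty and
     any bound serves. *)
  have [[a0 Aa0]|A0] := pselect (A !=set0); last first.
    by exists 0%R => a Aa; case: A0; exists a.
  case: (ld) => -[_ _ _ dT] _ _.
  exists (d 1%g a0 + M)%R => a Aa; apply: le_trans (dT _ a0 _) _.
  by rewrite lerD2l; exact: dM.
have [M dM] := bA d ld; apply/induced_coarseP; exists (M + M)%R => a b [Aa Ab].
case: (ld) => -[_ _ dC dT] _ _.
by apply: le_trans (dT _ 1 _) _; rewrite dC lerD ?dM.
Qed.

(** Left invariance gives $d(x,y)=d(1,x^{-1}y)$, so membership depends only on the set of quotients
    $x^{-1}y$. *)
Lemma left_coarseP E : left_coarse R G E <->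
  coarse_bounded (left_coarse R G) [set p.1^-1 * p.2 | p in E].
Proof.
split=> [LE|/left_boundedP bE d ld].
  apply/left_boundedP => d ld; have /induced_coarseP[M dM] := LE d ld.
  exists M => _ [[x y] Exy <-] /=; rewrite left_invariant_dist1//.
  exact: dM.
have [M dM] := bE d ld; apply/induced_coarseP; exists M => x y Exy.
by rewrite -left_invariant_dist1//; apply: dM; exists (x, y).
Qed.

Lemma left_bounded_subset A B : A `<=` B ->
  coarse_bounded (left_coarse R G) B -> coarse_bounded (left_coarse R G) A.
Proof. by move=> AB; apply: (coarse_subset left_coarse_structure); exact: setSX. Qed.

Lemma left_bounded1 (x : G) : coarse_bounded (left_coarse R G) [set x].
Proof. by apply/left_boundedP => d _; exists (d 1 x) => _ ->. Qed.

Lemma left_boundedU A B : coarse_bounded (left_coarse R G) A ->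
  coarse_bounded (left_coarse R G) B ->
  coarse_bounded (left_coarse R G) (A `|` B).
Proof.
move=> /left_boundedP bA /left_boundedP bB; apply/left_boundedP => d ld.
have [M dM] := bA d ld; have [N dN] := bB d ld.
exists (Num.max M N) => x; rewrite le_max.
by case=> [/dM ->|/dN ->]; rewrite ?orbT.
Qed.

Lemma left_boundedV A : coarse_bounded (left_coarse R G) A ->
  coarse_bounded (left_coarse R G) [set a^-1 | a in A].
Proof.
move=> /left_boundedP bA; apply/left_boundedP => d ld.
have [M dM] := bA d ld; exists M => _ [a Aa <-].
case: (ld) => -[_ _ dC _] _ _.
by rewrite -[a^-1]mulg1 left_invariant_dist1// dC; exact: dM.
Qed.

(** $d(1,ab)\le d(1,a)+d(a,ab)=d(1,a)+d(1,b)$. *)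
Lemma left_boundedM A B : coarse_bounded (left_coarse R G) A ->
  coarse_bounded (left_coarse R G) B ->
  coarse_bounded (left_coarse R G) [set a * b | a in A & b in B].
Proof.
move=> /left_boundedP bA /left_boundedP bB; apply/left_boundedP => d ld.
have [M dM] := bA d ld; have [N dN] := bB d ld.
exists (M + N)%R => _ [a Aa [b Bb <-]].
case: (ld) => -[_ _ _ dT] dl _; apply: le_trans (dT _ a _) _.
by rewrite lerD ?dM// -{1}[a]mulg1 dl dN.
Qed.

End LeftCoarse.

(** * The distance between cosets *)

Section Quotient.
Context (R : realType) {G : topologicalGroupType} (H : normalSubgroup G).
Local Notation Q := (quotient_group H).
Local Notation q := (quotient_map H).
Implicit Types (u v w : Q) (d : G -> G -> R) (E : set (Q * Q)).

Lemma quotient_mapM (x y : G) : q (x * y) = q x * q y.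
Proof. by rewrite [RHS]quotient_map_mul. Qed.

Lemma quotient_mapV (x : G) : q x^-1 = (q x)^-1.
Proof. by rewrite [RHS]quotient_map_inv. Qed.

(** A real-valued form of the Hausdorff distance, see [hausdorff_distE]. Taking the infimum over
    both representatives makes it visibly independent of choices and symmetric. *)
Definition coset_dist d u v : R :=
  inf [set d p.1 p.2 | p in coset_of_quotient u `*` coset_of_quotient v].

Lemma coset_dist_ge d u v (r : R) :
  (forall x y, q x = u -> q y = v -> r <= d x y)%R -> (r <= coset_dist d u v)%R.
Proof.
move=> rd; apply: lb_le_inf.
  have [x qx] := quotient_map_surj u; have [y qy] := quotient_map_surj v.
  by exists (d x y), (x, y).
by move=> _ [[x y] [/= qx qy] <-]; exact: rd.
Qed.

Section CosetDist.
Variable d : G -> G -> R.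
Hypothesis ld : left_invariant_pseudometric d.

Let dge0 x y : (0 <= d x y)%R. Proof. by case: ld => -[]. Qed.
Let dxx x : d x x = 0%R. Proof. by case: ld => -[]. Qed.
Let dC x y : d x y = d y x. Proof. by case: ld => -[]. Qed.
Let dT x y z : (d x z <= d x y + d y z)%R. Proof. by case: ld => -[]. Qed.
Let dl g x y : d (g * x) (g * y) = d x y. Proof. by case: ld. Qed.

Let dist_lbound (S : set (G * G)) : has_lbound [set d p.1 p.2 | p in S].
Proof. by exists 0%R => _ [p _ <-]. Qed.

Lemma coset_dist_le x y : (coset_dist d (q x) (q y) <= d x y)%R.
Proof. by apply: ge_inf; [exact: dist_lbound|exists (x, y)]. Qed.

(** Left translation by $x'x^{-1}$, an element of $H$, sends $x$ to $x'$, preserves [d] and keeps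
    $y$ in its coset. Hence one representative may be prescribed when computing [coset_dist]. *)
Lemma dist_change_repr (x x' y : G) : q x = q x' ->
  exists2 y', q y' = q y & d x' y' = d x y.
Proof.
move=> qx; exists (x' / x * y).
  by rewrite quotient_mapM quotient_mapM quotient_mapV qx mulgV mul1g.
by rewrite -{1}[x'](mulgVK x) dl.
Qed.

Lemma coset_dist_adherent x v (e : R) : (0 < e)%R ->
  exists2 y, q y = v & (d x y < coset_dist d (q x) v + e)%R.
Proof.
move=> e0; have [_ [[x' y'] [/= qx' qy'] <-] lte] :
    exists2 r, [set d p.1 p.2 | p in
      coset_of_quotient (q x) `*` coset_of_quotient v] r &
      (r < coset_dist d (q x) v + e)%R.
  apply: inf_adherent => //; split; last exact: dist_lbound.
  by have [y qy] := quotient_map_surj v; exists (d x y), (x, y).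
have [y qy dy] := dist_change_repr y' qx'.
by exists y; rewrite ?qy ?dy.
Qed.

Lemma coset_dist_pseudometric : pseudometric (coset_dist d).
Proof.
have distC u v : (coset_dist d u v <= coset_dist d v u)%R.
  by apply: coset_dist_ge => x y <- <-; rewrite dC; exact: coset_dist_le.
split.
- by move=> u v; exact: coset_dist_ge.
- move=> u; apply/eqP; rewrite eq_le coset_dist_ge// andbT.
  have [x <-] := quotient_map_surj u; rewrite -[leRHS](dxx x).
  exact: coset_dist_le.
- by move=> u v; apply/eqP; rewrite eq_le !distC.
- move=> u v w; apply/ler_addgt0Pl => e e0.
  have e20 : (0 < e / 2)%R by lra.
  (* The representatives are chosen successively, so that the two near-optimal pairs share the same
     [y]. *)
  have [x <-] := quotient_map_surj u.
  have [y <- dxy] := coset_dist_adherent x v e20.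
  have [z <- dyz] := coset_dist_adherent y w e20.
  have := coset_dist_le x z; have := dT x y z; lra.
Qed.

Lemma coset_dist_left_invariant u v w :
  coset_dist d (u * v) (u * w) = coset_dist d v w.
Proof.
have le u1 v1 w1 : (coset_dist d (u1 * v1)%g (u1 * w1)%g <= coset_dist d v1 w1)%R.
  have [x <-] := quotient_map_surj u1.
  apply: coset_dist_ge => y z <- <-; rewrite -!quotient_mapM -(dl x).
  exact: coset_dist_le.
apply/eqP; rewrite eq_le le /=.
(* The reverse inequality is [le] applied to translation by $u^{-1}$. *)
by rewrite -{1}[v](mulKg u) -{1}[w](mulKg u) le.
Qed.

Lemma coset_dist_left_invariant_pseudometric :
  left_invariant_pseudometric (coset_dist d).
Proof.
have pd := coset_dist_pseudometric.
split=> //; first exact: coset_dist_left_invariant.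
apply: pseudometric_continuous => // u e e0.
have [x <-] := quotient_map_surj u.
have dx : \forall y \near x, (d x y < e)%R.
  have : (fun y => d x y) @ x --> d x x.
    apply: (@continuous_comp _ _ _ (fun y => (x, y))
      (fun p : G * G => d p.1 p.2)); last by case: ld => _ _; exact.
    by apply: cvg_pair => /=; [exact: cvg_cst|exact: cvg_id].
  by rewrite dxx => /cvgr_lt; exact.
(* The quotient map is open, so the image of a [d]-ball around [x] is a neighbourhood of [q x]. *)
apply: filterS (quotient_map_nbhs H dx) => _ [y /= dy <-].
exact: le_lt_trans (coset_dist_le x y) dy.
Qed.

(** The distance from a point to a coset depends only on the coset of that point ([inf_from]), so
    both suprema in the Hausdorff distance run over a constant. *)
Lemma hausdorff_distE u v :
  hausdorff_dist d (coset_of_quotient u) (coset_of_quotient v) =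
  (coset_dist d u v)%:E.
Proof.
have inf_from a w :
    ereal_inf [set (d a b)%:E | b in coset_of_quotient w] =
    (coset_dist d (q a) w)%:E.
  rewrite -ereal_inf_EFin; last 2 first.
  - exact: dist_lbound.
  - by have [b qb] := quotient_map_surj w; exists (d a b), (a, b).
  congr ereal_inf; apply/seteqP; split=> [_ [b qb <-]|].
    by exists (d a b) => //; exists (a, b).
  move=> _ [_ [[a' b'] [/= qa' qb'] <-] <-].
  have [b qb db] := dist_change_repr b' qa'.
  by exists b; [exact: etrans qb qb'|rewrite db].
have sup_cst w (F : G -> \bar R) c : (forall a, q a = w -> F a = c) ->
    ereal_sup [set F a | a in coset_of_quotient w] = c.
  move=> Fc; rewrite (_ : [set _ | _ in _] = [set c]) ?ereal_sup1//.
  apply/seteqP; split=> [_ [a qa <-]|_ ->]; first exact: Fc.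
  by have [a qa] := quotient_map_surj w; exists a => //; exact: Fc.
rewrite /hausdorff_dist (sup_cst u _ (coset_dist d u v)%:E); last first.
  by move=> a <-; exact: inf_from.
rewrite (sup_cst v _ (coset_dist d u v)%:E) ?maxxx// => b <-.
rewrite (pseudometric_sym coset_dist_pseudometric) -inf_from.
by congr ereal_inf; apply: eq_imagel => a _; rewrite dC.
Qed.

End CosetDist.

(** * Inclusions between the coarse structures on the quotient *)

Lemma hausdorff_coarseP E : hausdorff_coarse R H E <->
  forall d, left_invariant_pseudometric d ->
    induced_coarse (fun u v => (coset_dist d u v)%:E) E.
Proof.
have eqD d : left_invariant_pseudometric d ->
    (fun u v => hausdorff_dist d (coset_of_quotient u) (coset_of_quotient v)) =
    (fun u v => (coset_dist d u v)%:E).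
  by move=> ld; apply/funext => u; apply/funext => v; exact: hausdorff_distE.
by split=> hE d ld; have := hE d ld; rewrite eqD.
Qed.

Lemma left_coarse_sub_hausdorff : left_coarse R Q `<=` hausdorff_coarse R H.
Proof.
move=> E LE; apply/hausdorff_coarseP => d ld.
exact/LE/coset_dist_left_invariant_pseudometric.
Qed.

(** [coset_dist d] is left invariant, so a bound [M] on [E] keeps every quotient $u^{-1}v$ within
    [M] of the identity, and any two quotients within [M + M]. *)
Lemma hausdorff_bounded_quotients E : hausdorff_coarse R H E ->
  coarse_bounded (hausdorff_coarse R H) [set p.1^-1 * p.2 | p in E].
Proof.
move=> /hausdorff_coarseP hE; apply/hausdorff_coarseP => d ld.
have ldq := coset_dist_left_invariant_pseudometric ld.
have /induced_coarseP[M dM] := hE d ld.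
apply/induced_coarseP; exists (M + M)%R => _ _ [/= [[u v] Euv <-] [[u' v'] Euv' <-]].
case: (ldq) => -[_ _ dC dT] _ _.
apply: le_trans (dT _ 1 _) _; rewrite dC !left_invariant_dist1//.
by apply: lerD; exact: dM.
Qed.

(** Used to see that the quotient map is controlled into the left coarse structure of $G/H$. *)
Lemma left_invariant_pullback (d : Q -> Q -> R) :
  left_invariant_pseudometric d ->
  left_invariant_pseudometric (fun x y => d (q x) (q y)).
Proof.
move=> [[dge0 dxx dC dT] dl cd]; split; first by split=> * //; exact: dT.
  by move=> g x y; rewrite !quotient_mapM dl.
move=> p.
have q1 : q x.1 @[x --> p] --> q p.1.
  apply: (@continuous_comp _ _ _ fst q); first exact: cvg_fst.
  exact: quotient_map_continuous.
have q2 : q x.2 @[x --> p] --> q p.2.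
  apply: (@continuous_comp _ _ _ snd q); first exact: cvg_snd.
  exact: quotient_map_continuous.
apply: (@continuous_comp _ _ _ (fun x : G * G => (q x.1, q x.2))
  (fun x : Q * Q => d x.1 x.2)); last exact: cd.
exact: cvg_pair q1 q2.
Qed.

Lemma quotient_coarse_sub_left : quotient_coarse R H `<=` left_coarse R Q.
Proof.
move=> E qE; apply: (qE (left_coarse R Q)); split.
  exact: left_coarse_structure.
move=> A LA d /left_invariant_pullback /LA /induced_coarseP[M dM].
apply/induced_coarseP; exists M => _ _ [[x y] Axy [<- <-]]; exact: dM.
Qed.

(** * Description of the quotient coarse structure *)

Let quotients_in_bounded E := exists2 A : set G,
  coarse_bounded (left_coarse R G) A &
  forall u v, E (u, v) -> (q @` A) (u^-1 * v).

Let quotients_in_bounded_coarse : coarse_structure quotients_in_bounded.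
Proof.
split.
- exists [set 1]; first exact: left_bounded1.
  by move=> u v /diagonalP ->; exists 1 => //; rewrite mulVg.
- by move=> E F EF [A bA AF]; exists A => // u v /EF /AF.
- move=> E F [A bA AE] [B bB BF].
  exists (A `|` B); first exact: left_boundedU.
  by move=> u v [/AE|/BF] [a ? <-]; exists a => //; [left|right].
- move=> E [A bA AE]; exists [set a^-1 | a in A]; first exact: left_boundedV.
  move=> u v /= /AE [a Aa qa]; exists a^-1; first by exists a.
  by rewrite quotient_mapV qa invgM invgK.
- move=> E F [A bA AE] [B bB BF].
  exists [set a * b | a in A & b in B]; first exact: left_boundedM.
  move=> u w /= [v /AE [a Aa qa] /BF [b Bb qb]].
  exists (a * b); first by exists a => //; exists b.
  (* $u^{-1}w=(u^{-1}v)(v^{-1}w)$. *)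
  by rewrite quotient_mapM qa qb mulgA mulgK.
Qed.

Lemma quotient_coarseP E : quotient_coarse R H E <->
  exists2 A : set G, coarse_bounded (left_coarse R G) A &
    forall u v, E (u, v) -> (q @` A) (u^-1 * v).
Proof.
split=> [qE|[A bA AE] F [csF qF]].
  apply: (qE quotients_in_bounded); split; first exact: quotients_in_bounded_coarse.
  move=> F /left_coarseP bF; exists [set p.1^-1 * p.2 | p in F] => //.
  move=> _ _ [[x y] Fxy [<- <-]]; exists (x^-1 * y); first by exists (x, y).
  by rewrite quotient_mapM quotient_mapV.
(* The largest relation on [G] with quotients in [A]. It is a left entourage, and its image contains
   [E]: if [x] lifts [u] and [a] lifts $u^{-1}v$, then [(x, x * a)] lifts [(u, v)]. *)
pose F' : set (G * G) := [set p | A (p.1^-1 * p.2)].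
apply: (coarse_subset csF) (qF F' _).
  move=> [u v] /AE [a Aa qa]; have [x qx] := quotient_map_surj u.
  exists (x, x * a); first by rewrite /F'/= mulKg.
  by rewrite /= quotient_mapM qx qa mulVKg.
apply/left_coarseP; apply: left_bounded_subset bA.
by move=> _ [[x y] Fxy <-].
Qed.

End Quotient.

(** * Equality of the structures and lifting of bounded sets *)

Theorem corollary1 (R : realType) (G : topologicalGroupType)
    (H : normalSubgroup G) (closedH : closed [set` H]) :
  (quotient_coarse R H = left_coarse R (quotient_group H) /\
   left_coarse R (quotient_group H) = hausdorff_coarse R H) <->
  (forall B : set (quotient_group H),
     coarse_bounded (hausdorff_coarse R H) B ->
     exists2 A : set G,
       coarse_bounded (left_coarse R G) A & B = quotient_map H @` A).
Proof.
split=> [[qL LH] B|lift].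
  rewrite -LH -qL => /quotient_coarseP[A bA AB].
  have [[u0 Bu0]|B0] := pselect (B !=set0); last first.
    exists set0; first by apply: left_bounded_subset (left_bounded1 1).
    rewrite image_set0; apply/seteqP; split=> u // Bu.
    by case: B0; exists u.
  have [x0 qx0] := quotient_map_surj u0.
  (* Since $u=u_0(u_0^{-1}u)$, the translate of [A] by [x0] covers [B]; intersecting with the
     preimage of [B] turns the covering into an equality. *)
  exists ([set x * a | x in [set x0] & a in A] `&` quotient_map H @^-1` B).
    apply: left_bounded_subset (left_boundedM (left_bounded1 x0) bA).
    exact: subIsetl.
  apply/seteqP; split=> [u Bu|_ [x [_ Bx] <-]//].
  have [a Aa qa] := AB u0 u (conj Bu0 Bu).
  have qxa : quotient_map H (x0 * a) = u by rewrite quotient_mapM qx0 qa mulVKg.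
  exists (x0 * a) => //; split; first by exists x0 => //; exists a.
  by rewrite /= qxa.
have Hq : hausdorff_coarse R H `<=` quotient_coarse R H.
  (* The lifting hypothesis is applied to the set of quotients of [E], not to [E] itself, and yields
     the bounded set that [quotient_coarseP] asks for. *)
  move=> E /hausdorff_bounded_quotients /lift [A bA AE].
  by apply/quotient_coarseP; exists A => // u v Euv; rewrite -AE; exists (u, v).
have qL := @quotient_coarse_sub_left R G H.
have LH := @left_coarse_sub_hausdorff R G H.
(* With [Hq] the chain of inclusions closes into a cycle. *)
split; apply/seteqP; split=> //.
- exact: subset_trans LH Hq.
- exact: subset_trans Hq qL.
Qed.
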